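(* Let $\langle X_i\rangle_{i\in I}$ be a sequence of compacta, let $X$ be a homogeneous compactum, and let $h\colon\prod_{i\in I}X_i\to X$ be a continuous surjection. If there is a regular cardinal $\kappa$ such that $w(X_i)<\kappa\leq w(X)$ for all $i\in I$, then every base of $X$ contains a subset that is a $\mu^{\mathrm{op}}$-like base of $X$, where $\mu=\sup_{i\in I}w(X_i)$. Otherwise, $w(X)\leq\sup_{i\in I}w(X_i)$ and every base of $X$ contains a subset that is a $(w(X)^+)^{\mathrm{op}}$-like base of $X$.
   Context: A compactum is a compact Hausdorff space; $w(\cdot)$ denotes weight. Families of open sets are ordered by inclusion; a family is $\lambda^{\mathrm{op}}$-like if no member is contained in $\lambda$-many members. *)

(* Defs.v *)
From HB Require Import structures.
From mathcomp Require Import all_boot all_order all_algebra.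
From mathcomp Require Import all_classical all_reals all_analysis.

Set Implicit Arguments. Unset Strict Implicit. Unset Printing Implicit Defensive.
Local Open Scope classical_set_scope.
Local Open Scope card_scope.

(* Cardinals are handled relationally (as in mathcomp's cardinality.v):
   a cardinal is represented by (the cardinality of) a set [A : set S]. *)

Definition is_base (T : topologicalType) (B : set (set T)) : Prop :=
  B `<=` open /\
  forall (U : set T) (x : T), open U -> U x -> exists V, B V /\ V x /\ V `<=` U.

(* Weight, with the usual convention w(T) = aleph_0 + min{|B| : B base of T}. *)
Definition weight_le (T : topologicalType) {S : Type} (A : set S) : Prop :=
  infinite_set A /\ exists B : set (set T), is_base B /\ (B #<= A).
Definition card_lt_weight {S : Type} (A : set S) (T : topologicalType) : Prop :=
  ~ weight_le T A.
Definition card_le_weight {S : Type} (A : set S) (T : topologicalType) : Prop :=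
  countable A \/ forall B : set (set T), is_base B -> (A #<= B).
Definition weight_lt (T : topologicalType) {S : Type} (A : set S) : Prop :=
  ~ card_le_weight A T.

(* |K| is a regular (infinite) cardinal: K is not the union of fewer than
   |K| subsets each of cardinality < |K| (index sets of size < |K| can be taken
   to be subsets of K). *)
Definition regular_card {S : Type} (K : set S) : Prop :=
  infinite_set K /\
  forall (J : set S) (F : S -> set S),
    J `<=` K -> ~ (K #<= J) ->
    (forall j, J j -> F j `<=` K /\ ~ (K #<= F j)) ->
    ~ (K `<=` \bigcup_(j in J) F j).

(* mu = sup_i w(X_i) (at least aleph_0, since each weight is).
   |A| < mu *)
Definition card_lt_supweight {I : Type} (X : I -> topologicalType)
  {S : Type} (A : set S) : Prop :=
  finite_set A \/ exists i, card_lt_weight A (X i).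
Definition weight_le_supweight (Y : topologicalType) {I : Type}
  (X : I -> topologicalType) : Prop :=
  forall (C : Type) (A : set C), infinite_set A ->
    (forall i, weight_le (X i) A) -> weight_le Y A.

Definition homogeneous (T : topologicalType) : Prop :=
  forall x y : T, exists (f g : T -> T),
    cancel f g /\ cancel g f /\ continuous f /\ continuous g /\ f x = y.

Definition supersets {T : Type} (F : set (set T)) (U : set T) : set (set T) :=
  [set V | F V /\ U `<=` V].

(* Main.v *)
(* Let lambda = w(X). A box is a finite-support basic open subset of the product, and it is fat
   if its image is somewhere dense. Let K <= lambda be regular, uncountable and above all w(X_i).
   Since fewer than K coordinates never determine h, some fat box contains K many pairs of boxes
   with pairwise disjoint supports (up to that of the fat box), the two members of each pair
   having separated images. If z lies in the first member of almost all pairs and h z is in the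
   interior of the closure of the image of the fat box, then no family of fewer than K nonempty
   open sets is a local pi-base at h z; by homogeneity this holds at every point. Hence every
   point has arbitrarily small neighbourhoods that contain no image of a fat box supported by a
   given set of fewer than lambda coordinates.
   Now treat the lambda many pairs (V, W) of basic open sets with cl V inside W one after the
   other, covering V by finitely many sets U inside W from the given base, all depending on a
   finite set T of coordinates, so that the image of a fat box c can only be inside U if the
   support of c meets T outside the coordinates used before. A nonempty set of the new base
   contains the image of some fat box, whose finite support meets the fresh coordinates of only
   finitely many stages, so it has only finitely many supersets: in the first case the base is
   even omega^op-like. *)
Require Import Defs.
From HB Require Import structures.
From mathcomp Require Import all_boot all_order all_algebra.
From mathcomp Require Import all_classical all_reals all_analysis.
From mathcomp Require wochoice.
Set Implicit Arguments. Unset Strict Implicit. Unset Printing Implicit Defensive.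
Local Open Scope classical_set_scope.
Local Open Scope card_scope.

(** * Cardinal arithmetic *)

(** Choice picks the images, so [R] need not be functional; relations avoid default values outside
    [A]. *)
Lemma card_le_rel {T U : Type} (A : set T) (B : set U) (R : T -> U -> Prop) :
  (forall a, A a -> exists2 b, B b & R a b) ->
  (forall a a' b, A a -> A a' -> R a b -> R a' b -> a = a') -> A #<= B.
Proof.
move=> Rt Ri.
have /choice[f fP] : forall a : A, exists b : B, R (val a) (val b).
  move=> a; have [b Bb Rab] := Rt _ (set_valP a).
  by exists (SigSub (mem_set Bb)).
apply/card_leP/injfunPex; exists f => // a a' _ _ faa'.
apply/val_inj/(Ri _ _ (val (f a))); try exact: set_valP; first exact: fP.
by rewrite faa'; exact: fP.
Qed.

Lemma card_le_relE {T U : Type} {A : set T} {B : set U} : A #<= B ->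
  exists R : T -> U -> Prop,
  [/\ forall a, A a -> exists2 b, B b & R a b,
      forall a b, R a b -> A a /\ B b,
      forall a a' b, R a b -> R a' b -> a = a' &
      forall a b b', R a b -> R a b' -> b = b'].
Proof.
move=> /card_leP/injfunPex[f _ fi].
exists (fun a b => exists x : A, val x = a /\ val (f x) = b); split.
- move=> a Aa; exists (val (f (SigSub (mem_set Aa)))); first exact: set_valP.
  by exists (SigSub (mem_set Aa)).
- by move=> a b [x [<- <-]]; split; exact: set_valP.
- move=> a a' b [x [<- <-]] [x' [<- /val_inj]] /fi ->; by rewrite ?inE.
- by move=> a b b' [x [<- <-]] [x' [/val_inj -> <-]].
Qed.

(* A maximal family of selectors that differ at every index exhausts some D k;
   evaluation at k' then injects D k into D k'. *)
Lemma card_min {K : Type} {T : K -> Type} (D : forall k, set (T k)) (k0 : K) :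
  exists k, forall k', D k #<= D k'.
Proof.
pose P (F : set (forall k, T k)) := (forall f k, F f -> D k (f k)) /\
  forall f g k, F f -> F g -> f k = g k -> f = g.
have [] := @Zorn_bigcup _ P.
  move=> G GP Gtot; split=> [f k [F GF]|f g k [F GF Ff] [F' GF' F'g]].
    exact: (GP F GF).1.
  have [FF'|F'F] := Gtot _ _ GF GF'.
    exact: ((GP F' GF').2 f g k (FF' _ Ff)).
  exact: ((GP F GF).2 f g k Ff (F'F _ F'g)).
move=> F [[Fin Finj] Fmax].
have [k kP] : exists k, forall t, D k t -> exists2 f, F f & f k = t.
  apply: contrapT => /forallNP noK.
  (* If every index misses a value, the missed values form a selector that could be added to [F]. *)
  have ex : forall k, exists t, D k t /\ forall f, F f -> f k <> t.
    move=> k; have /existsNP[t /not_implyP[Dt nt]] := noK k.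
    by exists t; split=> // f Ff fkt; apply: nt; exists f.
  pose g k := sval (cid (ex k)).
  have gP k : D k (g k) /\ forall f, F f -> f k <> g k := svalP (cid (ex k)).
  apply: (Fmax (F `|` [set g])).
    rewrite properEneq; split; last exact: subsetUl.
    apply/eqP => FE; have : F g by rewrite FE; right.
    by move=> /(proj2 (gP k0)); apply.
  split=> [f k [/Fin //|->]|f f' k [Ff|->] [Ff'|->] //]; first exact: (gP k).1.
  - exact: Finj.
  - by move=> e; case: ((gP k).2 _ Ff e).
  - by move=> /esym e; case: ((gP k).2 _ Ff' e).
exists k => k'; apply: (@card_le_rel _ _ _ _ (fun a b => exists2 f, F f & f k = a /\ f k' = b)).
  by move=> a /kP[f Ff fa]; exists (f k'); [exact: Fin|exists f].
by move=> a a' b _ _ [f Ff [<- <-]] [g Fg [<-]] /(Finj _ _ _ Fg Ff) ->.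
Qed.

Lemma card_le_total {T U : Type} (A : set T) (B : set U) : A #<= B \/ B #<= A.
Proof.
pose F (b : bool) : Type := if b then T else U.
have [[] /=] := @card_min bool F (fun b => if b return set (F b) then A else B) true.
  by move=> /(_ false); left.
by move=> /(_ true); right.
Qed.

Lemma card_leX {T T' U U' : Type} (A : set T) (A' : set T') (B : set U) (B' : set U') :
  A #<= B -> A' #<= B' -> A `*` A' #<= B `*` B'.
Proof.
move=> /card_le_relE[R [Rt _ Ri _]] /card_le_relE[R' [Rt' _ Ri' _]].
apply: (@card_le_rel _ _ _ _ (fun a b => R a.1 b.1 /\ R' a.2 b.2)).
  by move=> [a a'] [/= /Rt[b Bb Rab] /Rt'[b' Bb' Rab']]; exists (b, b').
move=> [a a'] [c c'] [b b'] _ _ [/= ab ab'] [cb cb'].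
by rewrite (Ri _ _ _ ab cb) (Ri' _ _ _ ab' cb').
Qed.

(** Two distinct points of [D] tag the copies of [A] and [A'] inside the square of [D]. *)
Lemma card_leU {T U : Type} (A A' : set T) (D : set U) : infinite_set D ->
  D `*` D #<= D -> A #<= D -> A' #<= D -> A `|` A' #<= D.
Proof.
move=> Dinf DD /card_le_relE[R [Rt _ Ri _]] /card_le_relE[R' [Rt' _ Ri' _]].
apply: card_le_trans DD.
have [d0 Dd0] := infinite_setN0 Dinf.
have [d1 [Dd1 d10]] : D `\ d0 !=set0.
  by apply/infinite_setN0/infinite_setD => //; exact: finite_set1.
apply: (@card_le_rel _ _ _ _ (fun a p => (p.1 = d0 /\ R a p.2) \/ (p.1 = d1 /\ R' a p.2))).
  move=> a [/Rt[b Db Rab]|/Rt'[b Db Rab]].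
    by exists (d0, b) => //; left.
  by exists (d1, b) => //; right.
move=> a a' [p1 p2] _ _ /= [[-> r]|[-> r]] [[e r']|[e r']].
- exact: Ri r r'.
- by case: d10.
- by case: d10.
- exact: Ri' r r'.
Qed.

(* Zorn on the graphs of injections D * D -> D with D an infinite subset of A. *)
Lemma card_le_sqr {T : Type} (A : set T) : infinite_set A -> A `*` A #<= A.
Proof.
move=> Ainf.
pose dom (G : set (T * T * T)) : set T := [set x | exists z, G (x, x, z)].
pose good (G : set (T * T * T)) := [/\ infinite_set (dom G), dom G `<=` A,
  forall x y, dom G x -> dom G y -> exists z, G (x, y, z),
  forall x y z, G (x, y, z) -> [/\ dom G x, dom G y & dom G z] &
  forall x y x' y' z, G (x, y, z) -> G (x', y', z) -> (x, y) = (x', y')].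
have good_le G : good G -> dom G `*` dom G #<= dom G.
  move=> [_ _ Gt Gd Gi].
  apply: (@card_le_rel _ _ _ _ (fun p z => G (p.1, p.2, z))).
    by move=> [x y] [/= Dx Dy]; have [z Gz] := Gt _ _ Dx Dy; exists z => //; case: (Gd _ _ _ Gz).
  by move=> [x y] [x' y'] z _ _ /=; exact: Gi.
(* The alternative [set0] is there for the empty chain. *)
have [] := @Zorn_bigcup _ [set G | G = set0 \/ good G].
  move=> F FP Ftot /=.
  have [F0|/existsNP[G0 /not_implyP[FG0 G00]]] := pselect (forall G, F G -> G = set0).
    by left; rewrite -subset0 => x [G /F0 ->].
  right.
  have FS G : F G -> G `<=` \bigcup_(X in F) X by move=> FG x Gx; exists G.
  have domS G : F G -> dom G `<=` dom (\bigcup_(X in F) X).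
    by move=> FG x [z Gz]; exists z; exists G.
  have ub G G' : F G -> F G' -> exists H, [/\ F H, G `<=` H & G' `<=` H].
    move=> FG FG'; have [s|s] := Ftot _ _ FG FG'.
      by exists G'; split=> //; exact: subset_refl.
    by exists G; split=> //; exact: subset_refl.
  have gd G x : F G -> G x -> good G by move=> FG Gx; have [e|//] := FP _ FG; rewrite e in Gx.
  split.
  - have [//|[inf _ _ _ _]] := FP _ FG0.
    by apply: sub_infinite_set inf; exact: domS.
  - by move=> x [z [G FG Gx]]; have [_ + _ _ _] := gd _ _ FG Gx; apply; exists z.
  - move=> x y [z [G FG Gx]] [z' [G' FG' Gy]].
    have [H [FH GH GH']] := ub _ _ FG FG'.
    have [_ _ Ht _ _] := gd _ _ FH (GH _ Gx).
    have [t Ht'] : exists t, H (x, y, t).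
      by apply: Ht; [exists z; exact: GH|exists z'; exact: GH'].
    by exists t, H.
  - move=> x y z [G FG Gx]; have [_ _ _ Gd _] := gd _ _ FG Gx.
    by have [? ? ?] := Gd _ _ _ Gx; split; exact: (domS G).
  - move=> x y x' y' z [G FG Gx] [G' FG' Gy].
    have [H [FH GH GH']] := ub _ _ FG FG'.
    have [_ _ _ _ Hi] := gd _ _ FH (GH _ Gx).
    exact: Hi (GH _ Gx) (GH' _ Gy).
move=> G [GP Gmax].
have {GP} Ggood : good G.
  case: GP => // G0; exfalso.
  (* A copy of the natural numbers in [A], with a pairing function, properly extends the empty
     graph. *)
  have /infiniteP/card_le_relE[R [Rt _ Ri Rf]] := Ainf.
  have /card_eqPle[/card_le_relE[N [Nt _ Ni Nf]] _] := card_nat2.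
  pose H : set (T * T * T) := fun t => exists m n k : nat,
    [/\ R m t.1.1, R n t.1.2, R k t.2, N (m, n) k & A t.1.1 /\ A t.1.2 /\ A t.2].
  have Hex m n : exists x y z k, [/\ R m x, R n y, R k z, N (m, n) k & H (x, y, z)].
    have [k _ Nk] := Nt (m, n) I.
    have [x Ax Rx] := Rt m I; have [y Ay Ry] := Rt n I; have [z Az Rz] := Rt k I.
    by exists x, y, z, k; split=> //; exists m, n, k.
  have domH x : dom H x <-> exists2 m, R m x & A x.
    split=> [[z [m [n [k [/= Rm _ _ _ [? _]]]]]]|[m Rm Ax]]; first by exists m.
    have [x' [y [z [k [Rx Ry Rz Nk Hz]]]]] := Hex m m.
    by exists z; move: Hz; rewrite -(Rf _ _ _ Rm Rx) -(Rf _ _ _ Rm Ry).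
  have domA : dom H `<=` A by move=> x /domH[].
  apply: (Gmax H); last first.
    right; split=> //.
    + apply/infiniteP/(@card_le_rel _ _ _ _ R); last by move=> a a' b _ _; exact: Ri.
      by move=> m _; have [x Ax Rx] := Rt m I; exists x => //; apply/domH; exists m.
    + move=> x y /domH[m Rm _] /domH[n Rn _].
      have [x' [y' [z [k [Rx Ry Rz Nk Hz]]]]] := Hex m n.
      by exists z; move: Hz; rewrite -(Rf _ _ _ Rm Rx) -(Rf _ _ _ Rn Ry).
    + move=> x y z [m [n [k [/= Rm Rn Rk _ [? [? ?]]]]]].
      by split; apply/domH; [exists m|exists n|exists k].
    + move=> x y x' y' z [m [n [k [/= Rm Rn Rk Nk _]]]] [m' [n' [k' [/= Rm' Rn' Rk' Nk' _]]]].
      rewrite -(Ri _ _ _ Rk Rk') in Nk'; have [em en] := Ni _ _ _ Nk Nk'.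
      by rewrite -em in Rm'; rewrite -en in Rn'; rewrite (Rf _ _ _ Rm Rm') (Rf _ _ _ Rn Rn').
  have [x [y [z [k [_ _ _ _ Hz]]]]] := Hex 0%N 0%N.
  by rewrite G0; split=> // /(_ _ Hz).
have Gle := good_le _ Ggood.
have [Ginf GA Gt Gd Gi] := Ggood.
set D := dom G in Ginf GA Gle.
(* Either [A] is no larger than [D] and inherits its square, or [A] minus [D] contains a copy [C] of
   [D], and sending the new pairs into [C] extends [G]. *)
have [AD|/card_subP[C CD CA]] := card_le_total (A `\` D) D.
  have AleD : A #<= D.
    apply: (@card_le_trans _ _ _ _ _ _ _ (_ : D `|` (A `\` D) #<= D)).
      by apply: subset_card_le => x Ax; have [|] := pselect (D x); [left|right].
    exact: card_leU.
  apply: (card_le_trans (card_leX AleD AleD)).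
  by apply: (card_le_trans Gle); exact: subset_card_le.
exfalso.
have /card_eqPle[CleD DleC] := CD.
pose N := D `|` C.
have disj x : D x -> C x -> False by move=> Dx /CA[].
have NC : (N `*` N) `\` (D `*` D) #<= C.
  apply: card_le_trans DleC.
  apply: (@card_le_trans _ _ _ _ _ _ _ (_ : (D `*` C) `|` ((C `*` D) `|` (C `*` C)) #<= D)).
    apply: subset_card_le => -[x y] [[/= [Dx|Cx] [Dy|Cy]] nD].
    - by case: nD.
    - by left.
    - by right; left.
    - by right; right.
  apply: card_leU => //; [|apply: card_leU => //];
    by apply: card_le_trans Gle; apply: card_leX.
have [R [Rt Rd Ri _]] := card_le_relE NC.
pose H : set (T * T * T) := G `|` [set t | R t.1 t.2].
have domH x : dom H x <-> N x.
  split.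
    move=> [z [Gx|/Rd[[[] //]]]]; left; by exists z.
  move=> Nx; have [Dx|nDx] := pselect (D x).
    by have [z Gz] := Gt _ _ Dx Dx; exists z; left.
  have [|z Cz Rz] := Rt (x, x); first by split=> // -[].
  by exists z; right.
apply: (Gmax H); last first.
  right; split.
  - apply: sub_infinite_set Ginf => x Dx; apply/domH; by left.
  - by move=> x /domH[/GA //|/CA[]].
  - move=> x y /domH Nx /domH Ny.
    have [[/= Dx Dy]|nD] := pselect ((D `*` D) (x, y)).
      by have [z] := Gt _ _ Dx Dy; exists z; left.
    have [|z Cz Rz] := Rt (x, y); first by split.
    by exists z; right.
  - move=> x y z [/Gd[Dx Dy Dz]|/Rd/=[[[/= Nx Ny] _] Cz]].
      by split; apply/domH; left.
    by split; apply/domH => //; right.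
  - move=> x y x' y' z [Gx|Rx] [Gy|Ry].
    + exact: Gi Gx Gy.
    + by have [_ _ Dz] := Gd _ _ _ Gx; have [_ /(disj _ Dz)] := Rd _ _ Ry.
    + by have [_ _ Dz] := Gd _ _ _ Gy; have [_ /(disj _ Dz)] := Rd _ _ Rx.
    + exact: Ri Rx Ry.
split; first exact: subsetUl.
have /infinite_setN0[x Cx] : infinite_set C by apply/infiniteP/(card_le_trans _ DleC)/infiniteP.
move=> HG; have /domH[z Hz] : N x by right.
by apply: (disj x) => //; exists z; exact: HG.
Qed.

(** An element is coded by one index together with its code in that member; [card_le_sqr] absorbs
    the pairs. *)
Lemma card_le_bigcup {S T U : Type} (N : set U) (J : set S) (F : S -> set T) :
  infinite_set N -> J #<= N -> (forall j, J j -> F j #<= N) ->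
  \bigcup_(j in J) F j #<= N.
Proof.
move=> Ninf /card_le_relE[R [Rt _ Ri _]] FN.
apply: card_le_trans (card_le_sqr Ninf).
have /choice[Q QP] : forall j, exists Q : T -> U -> Prop, J j ->
    (forall a, F j a -> exists2 b, N b & Q a b) /\
    forall a a' b, Q a b -> Q a' b -> a = a'.
  move=> j; have [/FN/card_le_relE[Q [Qt _ Qi _]]|nJ] := pselect (J j).
    by exists Q.
  by exists (fun _ _ => True).
apply: (@card_le_rel _ _ _ _
  (fun x p => exists j, [/\ J j, R j p.1 & Q j x p.2])).
  move=> x [j Jj Fx]; have [n Nn Rn] := Rt _ Jj.
  have [m Nm Qm] := (QP j Jj).1 _ Fx.
  by exists (n, m) => //; exists j.
move=> x x' [n m] _ _ [j [Jj Rj Qj]] [j' [_ /(Ri _ _ _ Rj) <-]].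
exact: (QP j Jj).2 Qj.
Qed.

Lemma cantor_powerset {T : Type} (A : set T) : ~ ([set: set T] #<= A).
Proof.
move=> /card_le_relE[R [Rt _ Ri Rf]].
pose D : set T := [set c | exists2 P, R P c & ~ P c].
have [d _ RD] := Rt D I.
have [Dd|nDd] := pselect (D d).
  by have [P /(Ri _ _ _ RD) <-] := Dd.
by apply: (nDd); exists D.
Qed.

(** The successor of [|A|] is a subset of the power set of least cardinality not embeddable in [A];
    it is regular because at most [|A|] sets of size at most [|A|] have a union of size at most
    [|A|]. *)
Lemma exists_succ_card {C : Type} (A : set C) : infinite_set A ->
  exists (S : Type) (K : set S), [/\ regular_card K, ~ (K #<= A) &
    forall (U : Type) (D : set U), ~ (D #<= A) -> K #<= D].
Proof.
move=> Ainf.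
have [[K KA] /= Kmin] := @card_min {D : set (set C) | ~ (D #<= A)} (fun _ => set C)
  (fun D => sval D) (exist _ setT (@cantor_powerset _ A)).
have Kle (U : Type) (D : set U) : ~ (D #<= A) -> K #<= D.
  move=> nDA; have [//|/card_subP[D' /card_eqPle[D'D DD'] _]] := card_le_total K D.
  apply: card_le_trans D'D; apply: (Kmin (exist _ D' _)) => D'A.
  exact/nDA/(card_le_trans DD').
exists (set C), K; split=> //; split.
  move=> Kfin; apply: KA; apply: (card_le_trans (finite_set_countable Kfin)).
  exact/infiniteP.
move=> J F JK KJ FP KU; apply: KA.
apply: (card_le_trans (subset_card_le KU)).
have le (D : set (set C)) : ~ (K #<= D) -> D #<= A.
  by move=> nKD; apply: contrapT => /Kle.
by apply: card_le_bigcup => // [|j /FP[_]]; exact: le.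
Qed.

(** The definition of regularity speaks of subsets of [K] only, so indices and members are pulled
    back into [K] along injections. *)
Lemma regular_card_bigcup {S U V : Type} (K : set S) (J : set U) (F : U -> set V) :
  regular_card K -> ~ (K #<= J) -> (forall j, J j -> ~ (K #<= F j)) ->
  ~ (K #<= \bigcup_(j in J) F j).
Proof.
move=> [_ Kreg] KJ KF /card_le_relE[R [Rt _ Ri _]].
have [//|/card_le_relE[Q [Qt Qd Qi Qf]]] := card_le_total K J.
pose J0 := [set k | exists j, Q j k].
pose G k := [set x | K x /\ exists j v, [/\ Q j k, F j v & R x v]].
apply: (Kreg J0 G).
- by move=> k [j /Qd[]].
- move=> KJ0; apply: KJ; apply: (card_le_trans KJ0).
  apply: (@card_le_rel _ _ _ _ (fun k j => Q j k)).
    by move=> k [j Qj]; exists j => //; case: (Qd _ _ Qj).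
  by move=> k k' j _ _; exact: Qf.
- move=> k [j Qj]; split; first by move=> x [].
  have [Jj _] := Qd _ _ Qj; move=> KG; apply: (KF j Jj).
  apply: (card_le_trans KG).
  apply: (@card_le_rel _ _ _ _ R); last by move=> a a' b _ _; exact: Ri.
  by move=> x [Kx [j' [v [/(Qi _ _ _ Qj) <- Fv Rv]]]]; exists v.
- move=> x Kx; have [v [j Jj Fv] Rv] := Rt _ Kx.
  have [k Kk Qk] := Qt _ Jj.
  by exists k; [exists j|split=> //; exists j, v].
Qed.

Lemma exists_strict_well_order (T : Type) : exists R : T -> T -> Prop,
  well_founded R /\ forall x y, x <> y -> R x y \/ R y x.
Proof.
have [R Rwo] := wochoice.well_ordering_principle {classic T}.
have Rtot : total R.
  move=> x y; exact: (@wochoice.wo_chainW _ R predT (fun A _ => @Rwo A)).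
have Ranti : antisymmetric R.
  move=> x y; exact: (@wochoice.wo_chain_antisymmetric _ R predT (fun A _ => @Rwo A)).
exists (fun x y => x <> y /\ R x y); split; last first.
  move=> x y xy; have /orP[?|?] := Rtot x y; [left|right]; split=> //.
  exact: nesym.
move=> x; apply: contrapT => nx.
pose P : {pred {classic T}} :=
  [pred y | `[< ~ Acc (fun x y => x <> y /\ R x y) y >]].
have [|z [[/asboolP nz zmin] _]] := Rwo P; first by exists x; apply/asboolP.
apply: nz; constructor => y [yz Ryz]; apply: contrapT => ny.
by apply: yz; apply: Ranti; rewrite Ryz zmin//; apply/asboolP.
Qed.

(* Pull a well-order back along an injection of L into its shortest initial
   segment of size at least that of L. *)
Lemma exists_initial_well_order {T : Type} (L : set T) :
  exists R : T -> T -> Prop, [/\ well_founded R,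
    forall x y, L x -> L y -> x <> y -> R x y \/ R y x &
    forall x, L x -> ~ (L #<= [set y | L y /\ R y x])].
Proof.
have [R [Rwf Rtot]] := exists_strict_well_order T.
have [noseg|/contrapT[x]] := pselect (~ exists x, L #<= [set y | R y x]).
  exists R; split=> // [x y _ _|x Lx LR]; first exact: Rtot.
  by apply: noseg; exists x; apply: (card_le_trans LR); apply: subset_card_le => y [].
elim/(well_founded_ind Rwf): x => x IH Lx.
(* Descending to a least point with a large enough initial segment makes all shorter segments too
   small. *)
have [[y Ryx Ly]|nosmall] := pselect (exists2 y, R y x & L #<= [set z | R z y]).
  exact: IH Ryx Ly.
have [f [ft fd fi ff]] := card_le_relE Lx.
exists (fun a b => exists u v, [/\ f a u, f b v & R u v]); split.
- have facc u : forall a, f a u -> Acc (fun a b => exists u v, [/\ f a u, f b v & R u v]) a.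
    elim/(well_founded_ind Rwf): u => u IHu a fau.
    by constructor => b [w [v [fbw /(ff _ _ _ fau) <- Rwu]]]; exact: IHu fbw.
  by move=> a; constructor => b [u [v [/facc]]].
- move=> a b /ft[u _ fa] /ft[v _ fb] ab.
  have uv : u <> v by move=> e; apply: ab; apply: fi fa _; rewrite e.
  by have [Ruv|Rvu] := Rtot _ _ uv; [left; exists u, v|right; exists v, u].
- move=> a La Lle; have [u Rux fa] := ft _ La.
  apply: nosmall; exists u => //; apply: (card_le_trans Lle).
  apply: (@card_le_rel _ _ _ _ f); last by move=> ? ? ? _ _; exact: fi.
  by move=> b [Lb [v [w [fbv /(ff _ _ _ fa) <- Rvu]]]]; exists v.
Qed.

(** * Sets of fewer than [K] elements, for [K] regular and uncountable *)

Section small_sets.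
Context {S : Type} (K : set S).
Hypothesis K_regular : regular_card K.
Hypothesis K_uncountable : ~ countable K.

Lemma small_countable {T : Type} (A : set T) : countable A -> ~ (K #<= A).
Proof. by move=> Ac KA; apply: K_uncountable; apply: card_le_trans KA Ac. Qed.

Lemma small_le {T U : Type} (A : set T) (B : set U) :
  A #<= B -> ~ (K #<= B) -> ~ (K #<= A).
Proof. by move=> AB KB KA; apply: KB; apply: card_le_trans KA AB. Qed.

Lemma small_sub {T : Type} (A B : set T) : A `<=` B -> ~ (K #<= B) -> ~ (K #<= A).
Proof. by move=> /subset_card_le; exact: small_le. Qed.

Lemma small_setU {T : Type} (A B : set T) :
  ~ (K #<= A) -> ~ (K #<= B) -> ~ (K #<= A `|` B).
Proof.
move=> KA KB; pose F (b : bool) := if b then A else B.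
apply: (@small_sub _ _ (\bigcup_(b in setT) F b)).
  by move=> x [Ax|Bx]; [exists true|exists false].
apply: regular_card_bigcup => // [|[] _] //.
exact: small_countable.
Qed.

(** Split by length: as [K] is uncountable, regularity absorbs the countable union over all
    lengths. *)
Lemma small_seq {T : eqType} (A : set T) : ~ (K #<= A) ->
  ~ (K #<= [set s : seq T | forall x, x \in s -> A x]).
Proof.
move=> KA.
pose L n := [set s : seq T | size s = n /\ forall x, x \in s -> A x].
apply: (@small_sub _ _ (\bigcup_(n in setT) L n)).
  by move=> s sA; exists (size s).
apply: regular_card_bigcup => // n _.
elim: n => [|n IH].
  apply: (@small_sub _ _ [set [::]]); first by move=> s [/size0nil].
  exact/small_countable/countable1.
apply: (@small_sub _ _ (\bigcup_(a in A) (cons a @` L n))).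
  move=> [[]//|a s] [[sn] sA]; exists a; first by apply: sA; rewrite mem_head.
  by exists s => //; split=> // x xs; apply: sA; rewrite inE xs orbT.
by apply: regular_card_bigcup => // a _; apply: small_le IH; exact: card_image_le.
Qed.

End small_sets.

(** If [P A] failed, the sets whose complement in [A] satisfies [P] would form a proper filter; a
    cluster point in [A] contradicts the local hypothesis. This replaces extracting finite
    subcovers. *)
Lemma compact_covering_ind {T : topologicalType} (A : set T) (P : set T -> Prop) :
  compact A -> P set0 -> (forall S S', S `<=` S' -> P S' -> P S) ->
  (forall S S', P S -> P S' -> P (S `|` S')) ->
  (forall x, A x -> exists U, [/\ open U, U x & P U]) -> P A.
Proof.
move=> Ac P0 Psub PU Ploc; apply: contrapT => nPA.
pose F : set_system T := [set S | P (A `\` S)].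
have FF : ProperFilter F.
  split; first by rewrite /F /= setD0.
  split; rewrite /F /=.
  - by rewrite setDT.
  - by move=> S S' PS PS' /=; rewrite setDIr; exact: PU.
  - by move=> S S' SS'; apply: Psub; exact: setDS.
have [|x [Ax Fx]] := Ac F FF; first by rewrite /F /= setDv.
have [U [oU Ux PU']] := Ploc x Ax.
have [|y [] //] := Fx (~` U) U _ (open_nbhs_nbhs (conj oU Ux)).
by rewrite /F /= setDE setCK; apply: Psub PU' => y [].
Qed.

(** * Boxes in products *)

Section boxes.
Context {I : Type} (Xi : I -> topologicalType) (Bas : forall i, set (set (Xi i))).
Arguments Bas : clear implicits.
Hypothesis Bas_base : forall i, is_base (Bas i).
Local Notation P := (prod_topology Xi).

(* A code is a finite list of constraints [z i \in V]; coordinates may repeat,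
   so that intersecting boxes is concatenating codes. *)
Definition constraint := {classic {i : I & set (Xi i)}}.
Definition code := seq constraint.

Definition box (c : code) : set P :=
  [set z | forall p : constraint, p \in c -> tagged p (z (tag p))].
Definition supported (J : set I) (c : code) :=
  forall p : constraint, p \in c -> J (tag p).
Definition support (c : code) : set I :=
  [set i | exists2 p : constraint, p \in c & tag p = i].
Definition basic (c : code) :=
  forall p : constraint, p \in c -> Bas (tag p) (tagged p).
Definition restrict (J : set I) (c : code) : code :=
  [seq p : constraint <- c | `[< J (tag p) >]].
Definition merge (J : set I) (z w : P) : P :=
  fun i => if pselect (J i) then z i else w i.

Lemma supported_sub (J J' : set I) (c : code) :
  J `<=` J' -> supported J c -> supported J' c.
Proof. by move=> JJ' Jc p /Jc/JJ'. Qed.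

Lemma supported_support (c : code) : supported (support c) c.
Proof. by move=> p pc; exists p. Qed.

Lemma finite_support (c : code) : finite_set (support c).
Proof.
apply: sub_finite_set (finite_image (fun p : constraint => tag p) (finite_seq c)).
by move=> i [p pc <-]; exists p.
Qed.

Lemma mem_box_cat (c d : code) (z : P) : box (c ++ d) z <-> box c z /\ box d z.
Proof.
split=> [cdz|[cz dz] p]; last by rewrite mem_cat => /orP[/cz|/dz].
by split=> p pc; apply: cdz; rewrite mem_cat pc ?orbT.
Qed.

Lemma basic_cat (c d : code) : basic c -> basic d -> basic (c ++ d).
Proof. by move=> bc bd p; rewrite mem_cat => /orP[/bc|/bd]. Qed.

Lemma supported_cat (J : set I) (c d : code) :
  supported J c -> supported J d -> supported J (c ++ d).
Proof. by move=> bc bd p; rewrite mem_cat => /orP[/bc|/bd]. Qed.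

Lemma supported_restrict (J : set I) (c : code) : supported J (restrict J c).
Proof. by move=> p; rewrite mem_filter => /andP[/asboolP]. Qed.

Lemma basic_restrict (J : set I) (c : code) : basic c -> basic (restrict J c).
Proof. by move=> bc p; rewrite mem_filter => /andP[_ /bc]. Qed.

Lemma sub_box_restrict (J : set I) (c : code) : box c `<=` box (restrict J c).
Proof. by move=> z cz p; rewrite mem_filter => /andP[_ /cz]. Qed.

Lemma box_restrictC (J : set I) (c : code) (z : P) :
  box (restrict J c) z -> box (restrict (~` J) c) z -> box c z.
Proof.
move=> Jz nJz p pc; have [Jp|nJp] := pselect (J (tag p)).
  by apply: Jz; rewrite mem_filter pc andbT; apply/asboolP.
by apply: nJz; rewrite mem_filter pc andbT; apply/asboolP.
Qed.

Lemma eq_box (J : set I) (c : code) (z w : P) :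
  supported J c -> (forall i, J i -> z i = w i) -> box c z -> box c w.
Proof. by move=> Jc zw cz p pc; rewrite -zw; [exact: cz|exact: Jc]. Qed.

Lemma mergeL (J : set I) (z w : P) i : J i -> merge J z w i = z i.
Proof. by rewrite /merge; case: pselect. Qed.

Lemma mergeR (J : set I) (z w : P) i : ~ J i -> merge J z w i = w i.
Proof. by rewrite /merge; case: pselect. Qed.

Lemma box_merge (J : set I) (c d : code) (z w : P) :
  supported J c -> supported (~` J) d -> box c z -> box d w ->
  box c (merge J z w) /\ box d (merge J z w).
Proof.
move=> Jc Jd cz dw; split.
  by apply: eq_box Jc _ cz => i Ji; rewrite mergeL.
by apply: eq_box Jd _ dw => i Ji; rewrite mergeR.
Qed.

Lemma open_proj i (V : set (Xi i)) : open V -> open [set z : P | V (z i)].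
Proof.
move=> oV; rewrite openE => z Vz.
have /cvg_sup/(_ i) : nbhs z --> z by exact: cvg_id.
by apply; exists [set w : P | V (w i)]; split=> //; exists V.
Qed.

Lemma open_box (c : code) : basic c -> open (box c).
Proof.
elim: c => [|p c IH] bc.
  rewrite (_ : box [::] = setT); first exact: openT.
  by apply/seteqP; split=> // z _ p.
rewrite (_ : box (p :: c) = [set z : P | tagged p (z (tag p))] `&` box c).
  apply: openI; last by apply: IH => q qc; apply: bc; rewrite inE qc orbT.
  by apply/open_proj/(Bas_base (tag p)).1/bc; rewrite mem_head.
apply/seteqP; split=> z.
  move=> pcz; split; first by apply: pcz; rewrite mem_head.
  by move=> q qc; apply: pcz; rewrite inE qc orbT.
by move=> [pz cz] q; rewrite inE => /orP[/eqP ->|/cz].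
Qed.

(** The sets containing a basic box around [z] form a filter, which converges to [z] because it does
    so in every coordinate. *)
Lemma basic_box_nbhs (O : set P) (z : P) : open O -> O z ->
  exists c, [/\ basic c, box c z & box c `<=` O].
Proof.
move=> oO Oz.
pose F : set_system P := [set S | exists c, [/\ basic c, box c z & box c `<=` S]].
have FF : Filter F.
  split.
  - by exists [::]; split.
  - move=> S S' [c [bc cz cS]] [d [bd dz dS]]; exists (c ++ d); split.
    + exact: basic_cat.
    + exact/mem_box_cat.
    + by move=> w /mem_box_cat[/cS ? /dS].
  - by move=> S S' SS' [c [bc cz cS]]; exists c; split=> // w /cS/SS'.
suff : F --> z by apply; exact: open_nbhs_nbhs.
apply/cvg_sup => i A [U [[V oV <-] Vz] VA].
have [W [BW [Wz WV]]] := (Bas_base i).2 V (z i) oV Vz.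
exists [:: existT _ i W : constraint]; split.
- by move=> p; rewrite inE => /eqP ->.
- by move=> p; rewrite inE => /eqP ->.
- by move=> w wW; apply/VA/WV; have := wW (existT _ i W); apply; rewrite mem_head.
Qed.

Lemma small_basic_codes {S : Type} (K : set S) (J : set I) :
  regular_card K -> ~ countable K -> (forall i, ~ (K #<= Bas i)) -> ~ (K #<= J) ->
  ~ (K #<= [set c | basic c /\ supported J c]).
Proof.
move=> Kreg Kunc KBas KJ.
pose A : set constraint :=
  \bigcup_(i in J) ((fun V => existT _ i V : constraint) @` Bas i).
apply: (@small_sub _ _ _ _ [set c : code | forall p : constraint, p \in c -> A p]).
  move=> c [bc Jc] p pc; exists (tag p); first exact: Jc.
  by exists (tagged p); [exact: bc|case: {+}p].
apply: small_seq => //; apply: regular_card_bigcup => // i _.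
by apply: small_le (KBas i); exact: card_image_le.
Qed.

End boxes.

(** * Continuous images of products *)

Section image_of_product.
Context {I : Type} (Xi : I -> topologicalType) (Bas : forall i, set (set (Xi i))).
Arguments Bas : clear implicits.
Hypothesis Bas_base : forall i, is_base (Bas i).
Hypothesis Xi_compact : forall i, compact [set: Xi i].
Hypothesis Xi_hausdorff : forall i, hausdorff_space (Xi i).
Context {X : topologicalType}.
Hypothesis X_hausdorff : hausdorff_space X.
Local Notation P := (prod_topology Xi).
Local Notation basic := (basic Bas).
Context (h : P -> X).
Hypothesis h_cont : continuous h.
Hypothesis h_surj : forall x : X, exists z, h z = x.

(* Somewhere dense image, phrased without closures. *)
Definition fat (N : set P) := exists O : set X, [/\ open O, O !=set0 &
  forall O', open O' -> O' !=set0 -> O' `<=` O -> exists2 z, N z & O' (h z)].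

(* The core still maps onto X, and all its neighbourhoods are fat. *)
Definition core : set P := [set z | forall N, open N -> N z -> fat N].

Lemma fat_sub (N M : set P) : N `<=` M -> fat N -> fat M.
Proof.
move=> NM [ O [oO O0 ON]]; exists O; split=> // O' oO' O'0 O'O.
by have [z Nz Oz] := ON _ oO' O'0 O'O; exists z => //; exact: NM.
Qed.

Lemma fat_nonempty (N : set P) : fat N -> N !=set0.
Proof.
move=> [ O [oO O0 ON]]; have [z Nz _] := ON _ oO O0 (@subset_refl _ O).
by exists z.
Qed.

(** If [N] is not fat, a nonempty open subset of [O] misses its image, and density there has to come
    from [M]. *)
Lemma fat_setU (N M : set P) : fat (N `|` M) -> fat N \/ fat M.
Proof.
move=> [ O [oO O0 ONM]].
have [?|nN] := pselect (fat N); [by left|right].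
have [ O1 [oO1 O10 O1O nN1]] : exists O1, [/\ open O1, O1 !=set0, O1 `<=` O &
    forall z, N z -> ~ O1 (h z)].
  apply: contrapT => no; apply: nN; exists O; split=> // O' oO' O'0 O'O.
  apply: contrapT => no'; apply: no; exists O'; split=> // z Nz Oz.
  by apply: no'; exists z.
exists O1; split=> // O' oO' O'0 O'O1.
have [z [Nz|Mz] Oz] := ONM _ oO' O'0 (subset_trans O'O1 O1O); last by exists z.
by case: (nN1 z Nz); exact: O'O1.
Qed.

Lemma product_compact : compact [set: P].
Proof.
rewrite (_ : [set: P] = [set f | forall i, setT (f i)]).
  exact: (@tychonoff {classic I} Xi (fun=> setT)).
by apply/seteqP; split.
Qed.

Lemma image_closed (A : set P) : closed A -> closed (h @` A).
Proof.
move=> cA; apply: compact_closed => //; apply: continuous_compact.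
  exact: continuous_subspaceT.
exact: subclosed_compact cA product_compact _.
Qed.

Lemma core_closed : closed core.
Proof.
rewrite -openC openE => z /existsNP[N /not_implyP[oN /not_implyP[Nz nN]]].
apply: filterS (open_nbhs_nbhs (conj oN Nz)) => w Nw cw.
exact/nN/cw.
Qed.

(** Otherwise finitely many open sets that are not fat cover the compact fibre over [x]. Their union
    is not fat, yet its image contains an open neighbourhood of [x], because [h] is closed and
    onto. *)
Lemma core_surj (x : X) : exists2 z, core z & h z = x.
Proof.
apply: contrapT => nx.
have cpt : compact (h @^-1` [set x]).
  apply: subclosed_compact product_compact _ => //.
  apply: preimage_closed; first by move=> *; exact: h_cont.
  exact/accessible_closed_set1/hausdorff_accessible.
have [N [oN xN]] : exists N, [/\ open N, h @^-1` [set x] `<=` N & ~ fat N].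
  apply: (compact_covering_ind (P := fun S => exists N, [/\ open N, S `<=` N & ~ fat N]) cpt).
  - exists set0; split=> //; first exact: open0.
    by move=> /fat_nonempty[].
  - by move=> S S' SS' [N [oN SN nN]]; exists N; split=> // z /SS'/SN.
  - move=> S S' [N [oN SN nN]] [N' [oN' SN' nN']]; exists (N `|` N'); split.
    + exact: openU.
    + by move=> z [/SN|/SN']; [left|right].
    + by move=> /fat_setU[].
  - move=> z hz; have : ~ core z by move=> cz; apply: nx; exists z.
    move=> /existsNP[N /not_implyP[oN /not_implyP[Nz nN]]].
    by exists N; split=> //; exists N; split=> //; exact: subset_refl.
apply; exists (~` (h @` (~` N))); split.
- by rewrite openC; apply: image_closed; exact: open_closedC.
- by exists x => -[z nNz hz]; apply: nNz; exact: xN.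
- move=> O' _ [y Oy] O'O; have [z hz] := h_surj y.
  exists z; last by rewrite hz.
  by apply: contrapT => nNz; apply: (O'O y Oy); exists z.
Qed.

Lemma exists_fat_box (U : set X) : open U -> U !=set0 ->
  exists c, [/\ basic c, fat (box c) & forall z, box c z -> U (h z)].
Proof.
move=> oU [x Ux]; have [z cz hz] := core_surj x.
have oV : open (h @^-1` U) by exact: (continuousP h).1.
have [|c [bc cz' cU]] := basic_box_nbhs Bas_base oV (z := z); first by rewrite /= hz.
exists c; split=> //; apply: cz => //; exact: open_box bc.
Qed.

(** * Large pi-character at every point *)

Section fixed_cardinal.
Context {S : Type} (K : set S).
Hypothesis K_regular : regular_card K.
Hypothesis K_uncountable : ~ countable K.
Hypothesis K_Bas : forall i, ~ (K #<= Bas i).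
Hypothesis K_weight : forall B : set (set X), is_base B -> K #<= B.

(** If [h] on the core depended only on the coordinates in [J], the sets [O F] below, indexed by
    finite lists of basic codes supported in [J], would be a base of fewer than [K] sets. *)
Lemma exists_core_pair (J : set I) : ~ (K #<= J) ->
  exists y y', [/\ core y, core y', forall i, J i -> y i = y' i & h y <> h y'].
Proof.
move=> KJ; apply: contrapT => no.
have det y y' : core y -> core y' -> (forall i, J i -> y i = y' i) -> h y = h y'.
  by move=> cy cy' yy'; apply: contrapT => hyy'; apply: no; exists y, y'.
pose Cd := [set c | basic c /\ supported J c].
pose FF := [set F : seq {classic (code Xi)} |
  forall c : {classic (code Xi)}, c \in F -> Cd c].
pose un (F : seq {classic (code Xi)}) : set P :=
  [set z | exists2 c : {classic (code Xi)}, c \in F & box c z].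
pose O F := ~` (h @` (core `&` ~` un F)).
have KFF : ~ (K #<= FF).
  by apply: small_seq => //; exact: small_basic_codes.
have oun F : FF F -> open (un F).
  move=> FC; rewrite openE => z [c cF cz].
  apply: (@filterS _ _ _ (box c)); first by move=> w cw; exists c.
  by apply: open_nbhs_nbhs; split=> //; apply: open_box (FC c cF).1.
apply: KFF; apply: (@card_le_trans _ _ _ (O @` FF)); last exact: card_image_le.
apply: K_weight; split.
  move=> _ [F FC <-]; rewrite openC; apply: image_closed.
  by apply: closedI; [exact: core_closed|exact/open_closedC/oun].
move=> W x oW Wx.
have oV : open (h @^-1` W) by exact: (continuousP h).1.
pose A := core `&` h @^-1` [set x]; pose D := core `&` ~` (h @^-1` W).
have Ac : compact A.
  apply: subclosed_compact product_compact _ => //.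
  apply: closedI; first exact: core_closed.
  apply: preimage_closed; first by move=> *; exact: h_cont.
  exact/accessible_closed_set1/hausdorff_accessible.
have Dc : compact D.
  apply: subclosed_compact product_compact _ => //.
  by apply: closedI; [exact: core_closed|exact: open_closedC].
(* By [det], a point of the fibre differs from each point of [D] in a coordinate of [J]; compactness
   of [D] then gives one box around [z] that avoids [D]. *)
have sep z : A z -> exists c, [/\ Cd c, box c z & D `<=` ~` box c].
  move=> [cz hz].
  pose Q (S : set P) := exists c, [/\ Cd c, box c z & S `<=` ~` box c].
  apply: (compact_covering_ind (P := Q) Dc).
  - by exists [::]; split.
  - by move=> S1 S2 S12 [c [Cc cz' S2c]]; exists c; split=> // w /S12/S2c.
  - move=> S1 S2 [c [[bc Jc] cz' Sc]] [d [[bd Jd] dz' Sd]]; exists (c ++ d); split.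
    + by split; [exact: basic_cat|exact: supported_cat].
    + exact/mem_box_cat.
    + by move=> w [/Sc|/Sd] nw /mem_box_cat[].
  - move=> w [cw nWw].
    have [i Ji zw] : exists2 i, J i & z i <> w i.
      apply: contrapT => nozw; apply: nWw; rewrite /= -(det z w) ?hz//.
      by move=> i Ji; apply: contrapT => zw; apply: nozw; exists i.
    have := @Xi_hausdorff i; rewrite open_hausdorff => /(_ (z i) (w i)).
    case; first exact/eqP.
    move=> [V V'] /= [/set_mem zV /set_mem wV'] [oV1 oV' /eqP VV'].
    have [V1 [BV1 [zV1 V1V]]] := (Bas_base i).2 _ _ oV1 zV.
    exists [set u : P | V' (u i)]; split=> //; first exact: open_proj.
    exists [:: existT _ i V1 : constraint Xi]; split.
    + by split=> p; rewrite inE => /eqP ->.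
    + by move=> p; rewrite inE => /eqP ->.
    + move=> u V'u uc; have : set0 (u i); last by [].
      rewrite -VV'; split=> //; apply: V1V.
      by have := uc (existT _ i V1); apply; rewrite mem_head.
have [F [FC AF FD]] : exists F, [/\ FF F, A `<=` un F & D `<=` ~` un F].
  pose Q (S : set P) := exists F, [/\ FF F, S `<=` un F & D `<=` ~` un F].
  apply: (compact_covering_ind (P := Q) Ac).
  - by exists [::]; split=> // z _ [c].
  - by move=> S1 S2 S12 [F [FC SF DF]]; exists F; split=> // z /S12/SF.
  - move=> S1 S2 [F [FC SF DF]] [G [GC SG DG]]; exists (F ++ G); split.
    + by move=> c; rewrite mem_cat => /orP[/FC|/GC].
    + by move=> z [/SF|/SG] [c cF cz]; exists c; rewrite // mem_cat cF ?orbT.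
    + move=> z Dz [c]; rewrite mem_cat => /orP[cF|cG] cz.
        by apply: (DF z Dz); exists c.
      by apply: (DG z Dz); exists c.
  - move=> z Az; have [c [Cc cz cD]] := sep z Az.
    exists (box c); split=> //; first exact: open_box Cc.1.
    exists [:: c : {classic (code Xi)}]; split.
    + by move=> d; rewrite inE => /eqP ->.
    + by move=> w cw; exists c; rewrite // mem_head.
    + by move=> w Dw [d]; rewrite inE => /eqP ->; exact: cD.
exists (O F); split; first by exists F.
split.
  by move=> [z [cz nFz] hz]; apply: nFz; exact: AF.
move=> y Oy; have [z cz hz] := core_surj y.
apply: contrapT => nWy; apply: Oy; exists z => //; split=> //.
by apply: FD; split=> //; rewrite /= hz.
Qed.

(** Only the parts of the two boxes inside [box e] are kept apart, so their supports can avoid that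
    of [e]. *)
Definition separated (e : code Xi) (q : code Xi * code Xi) :=
  [/\ box q.1 !=set0, box q.2 !=set0 & exists O1 O2 : set X,
    [/\ open O1, open O2, O1 `&` O2 = set0,
      forall z, box e z -> box q.1 z -> O1 (h z) &
      forall z, box e z -> box q.2 z -> O2 (h z)]].

Definition splits (e : code Xi) := forall J : set I, ~ (K #<= J) ->
  exists q, [/\ supported (~` J) q.1, supported (~` J) q.2 & separated e q].

(** Otherwise every basic fat box [e] has a small set [Je e] defeating all pairs. For a small [J]
    closed under [Je], two core points that agree on [J] but have distinct images give boxes whose
    restrictions to [J] form [e] and whose remainders form a forbidden pair. *)
Lemma exists_splitting_code :
  exists e, [/\ basic e, fat (box e) & splits e].
Proof.
apply: contrapT => no.
have /choice[Je JeP] : forall e, exists J, ~ (K #<= J) /\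
    (basic e -> fat (box e) -> forall q, supported (~` J) q.1 ->
      supported (~` J) q.2 -> ~ separated e q).
  move=> e; have [[be fe]|nbf] := pselect (basic e /\ fat (box e)); last first.
    exists set0; split; first exact/small_countable/countable0.
    by move=> be fe; case: nbf.
  have : ~ splits e by move=> se; apply: no; exists e.
  move=> /existsNP[J /not_implyP[KJ noq]]; exists J; split=> // _ _ q q1 q2 sq.
  by apply: noq; exists q.
(* Close off under Je, so that a box supported in J has its Je inside J. *)
pose Jn := fix Jn n := if n is m.+1 then
  Jn m `|` \bigcup_(e in [set c | basic c /\ supported (Jn m) c]) Je e else set0.
have KJn n : ~ (K #<= Jn n).
  elim: n => [|n IH] /=; first exact/small_countable/countable0.
  apply: small_setU => //; apply: regular_card_bigcup => //.
    exact: small_basic_codes.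
  by move=> e _; exact: (JeP e).1.
have Jn_mono m n : Jn m `<=` Jn (m + n)%N.
  elim: n => [|n IH]; first by rewrite addn0.
  by rewrite addnS => i /IH ?; left.
pose J := \bigcup_(n in setT) Jn n.
have KJ : ~ (K #<= J) by apply: regular_card_bigcup.
have supJ e : supported J e -> exists n, supported (Jn n) e.
  elim: e => [|p e IH] Je'; first by exists 0%N.
  have [n en] : exists n, supported (Jn n) e.
    by apply: IH => q qe; apply: Je'; rewrite inE qe orbT.
  have [m _ pm] := Je' p (mem_head _ _).
  exists (m + n)%N => q; rewrite inE => /orP[/eqP ->|qe]; first exact: Jn_mono.
  by rewrite addnC; apply/Jn_mono/en.
have [y [y' [cy cy' yy' hyy']]] := exists_core_pair KJ.
have := X_hausdorff; rewrite open_hausdorff => /(_ (h y) (h y')).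
case; first exact/eqP.
move=> [ O1 O2] /= [/set_mem yO1 /set_mem yO2] [oO1 oO2 /eqP O12].
have [a [ba ay aO]] := basic_box_nbhs Bas_base ((continuousP h).1 h_cont _ oO1) (z := y) yO1.
have [a' [ba' ay' aO']] := basic_box_nbhs Bas_base ((continuousP h).1 h_cont _ oO2) (z := y') yO2.
(* e contains y because y and y' agree on J. *)
pose e := restrict J a ++ restrict J a'.
have be : basic e by apply: basic_cat; exact: basic_restrict.
have ey : box e y.
  apply/mem_box_cat; split; first exact: sub_box_restrict ay.
  apply: (eq_box (J := J) (z := y')); first exact: supported_restrict.
    by move=> i Ji; rewrite yy'.
  exact: sub_box_restrict ay'.
have fe : fat (box e) by apply: cy => //; exact: open_box be.
have Jee : Je e `<=` J.
  have [n en] : exists n, supported (Jn n) e.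
    by apply: supJ; apply: supported_cat; exact: supported_restrict.
  by move=> i Jei; exists n.+1 => //; right; exists e.
have sup (c : code Xi) : supported (~` Je e) (restrict (~` J) c).
  apply: (supported_sub (J := ~` J)); last exact: supported_restrict.
  by move=> i nJi /Jee.
apply: ((JeP e).2 be fe (restrict (~` J) a, restrict (~` J) a')); [exact: sup|exact: sup|].
split.
- by exists y; exact: sub_box_restrict ay.
- by exists y'; exact: sub_box_restrict ay'.
- exists O1, O2; split=> //.
  + by move=> z /mem_box_cat[ez _] az; apply/aO/(box_restrictC ez az).
  + by move=> z /mem_box_cat[_ ez] az; apply/aO'/(box_restrictC ez az).
Qed.

(** The point is [h z] with [z] in the first member of almost all pairs of a maximal family with
    disjoint supports, so its pi-character is at least [K]. *)
Lemma exists_large_pi_character : exists p : X, forall VV : set (set X),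
  ~ (K #<= VV) -> (forall V, VV V -> open V /\ V !=set0) ->
  exists O, [/\ open O, O p & forall V, VV V -> ~ (V `<=` O)].
Proof.
have [e [be fe spl]] := exists_splitting_code.
have [z1 ez1] := fat_nonempty fe.
pose sup (q : code Xi * code Xi) := support q.1 `|` support q.2.
have sup_small q : ~ (K #<= sup q).
  by apply/small_countable => //; apply: finite_set_countable;
     rewrite finite_setU; split; exact: finite_support.
have [] := @Zorn_bigcup _ [set F | (forall q, F q -> separated e q) /\
    forall q q' i, F q -> F q' -> sup q i -> sup q' i -> q = q'].
  move=> G GP Gtot; split=> [q [F GF Fq]|q q' i [F GF Fq] [F' GF' Fq']].
    exact: (GP F GF).1.
  have [FF'|F'F] := Gtot _ _ GF GF'.
    exact: ((GP F' GF').2 q q' i (FF' _ Fq)).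
  exact: ((GP F GF).2 q q' i Fq (F'F _ Fq')).
move=> F [[Fsep Fdisj] Fmax].
(* Fewer than [K] pairs would use fewer than [K] coordinates, and [splits] would give a further pair
   off those. *)
have KF : ~ ~ (K #<= F).
  move=> KF; pose J := \bigcup_(q in F) sup q.
  have KJ : ~ (K #<= J) by apply: regular_card_bigcup.
  have [q [q1 q2 sq]] := spl J KJ.
  have qJ i : sup q i -> ~ J i by move=> [|] [p pq <-]; [exact: q1|exact: q2].
  have Fq : F q.
    apply: contrapT => nFq; apply: (Fmax (F `|` [set q])).
      split; first exact: subsetUl.
      by move=> /(_ q); apply: contra_not nFq; apply; right.
    split=> [r [/Fsep//|->//]|r r' i [Fr|->] [Fr'|->] //].
    - exact: Fdisj.
    - by move=> ri /qJ; case; exists r.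
    - by move=> /qJ + r'i; case; exists r'.
  (* A pair of [F] that is off all supports has empty support: both boxes are the whole product and
     cannot be separated. *)
  have q0 i : ~ sup q i by move=> qi; apply: (qJ i qi); exists q.
  have [_ _ [ O1 [ O2 [_ _ O12 eO1 eO2]]]] := sq.
  have : set0 (h z1); last by [].
  rewrite -O12; split; [apply: eO1 => //|apply: eO2 => //] => p pq.
    by case: (q0 (tag p)); left; exists p.
  by case: (q0 (tag p)); right; exists p.
(* Each coordinate lies in the support of at most one pair, so fewer than [K] coordinates meet fewer
   than [K] supports. *)
have off J : ~ (K #<= J) -> exists2 q, F q & forall i, sup q i -> ~ J i.
  move=> KJ; apply: contrapT => no; apply: KF.
  apply: (small_sub (B := \bigcup_(i in J) [set q | F q /\ sup q i])).
    move=> q Fq; apply: contrapT => nq; apply: no; exists q => // i qi Ji.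
    by apply: nq; exists i.
  apply: regular_card_bigcup => // i _; apply: small_countable => //.
  apply: (@card_le_rel _ _ _ _ (fun q n => n = 0%N)); first by move=> q _; exists 0%N.
  by move=> q q' _ [Fq qi] [Fq' qi'] _ _; exact: Fdisj qi qi'.
have [ OE [oOE OE0 OEP]] := fe.
have [z0 ez0 Oz0] := OEP _ oOE OE0 (@subset_refl _ OE).
have oG : open (box e `&` h @^-1` OE).
  by apply: openI; [exact: open_box be|exact: (continuousP h).1].
have [c0 [bc0 c0z c0G]] := basic_box_nbhs Bas_base oG (conj ez0 Oz0).
pose away q := forall i, sup q i -> ~ support c0 i.
have /choice[w wP] : forall q, exists w, F q -> box q.1 w.
  move=> q; have [Fq|] := pselect (F q); last by exists z0.
  by have [[w qw] _ _] := Fsep _ Fq; exists w.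
(* [z] copies [w q] on the support of each pair away from [c0], and [z0] elsewhere; disjoint
   supports make this consistent. *)
have zex i : exists v : Xi i,
    (forall q, F q -> sup q i -> away q -> v = w q i) /\
    ((forall q, F q -> sup q i -> ~ away q) -> v = z0 i).
  have [[q [Fq qi aq]]|noq] := pselect (exists q, [/\ F q, sup q i & away q]).
    exists (w q i); split=> [q' Fq' q'i _|/(_ q Fq qi)//].
    by rewrite (Fdisj q q' i).
  exists (z0 i); split=> // q Fq qi aq; by case: noq; exists q.
pose z : P := fun i => sval (cid (zex i)).
have zq q i : F q -> sup q i -> away q -> z i = w q i := (svalP (cid (zex i))).1 q.
have z00 i : (forall q, F q -> sup q i -> ~ away q) -> z i = z0 i :=
  (svalP (cid (zex i))).2.
have c0z' : box c0 z.
  apply: (eq_box (supported_support (c := c0)) _ c0z) => i ci.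
  by rewrite z00 // => q Fq qi /(_ i qi).
have [ez Oz] := c0G _ c0z'.
exists (h z) => VV KVV VVo.
have /choice[g gP] : forall V, exists c, VV V -> V `<=` OE ->
    [/\ box c !=set0, box c `<=` box e & forall z, box c z -> V (h z)].
  move=> V; have [[VVV VO]|nV] := pselect (VV V /\ V `<=` OE); last first.
    by exists [::] => VVV VO; case: nV.
  have [oV V0] := VVo V VVV.
  have [y ey Vy] := OEP V oV V0 VO.
  have oH : open (box e `&` h @^-1` V).
    by apply: openI; [exact: open_box be|exact: (continuousP h).1].
  have [c [bc cy cH]] := basic_box_nbhs Bas_base oH (conj ey Vy).
  by exists c => _ _; split; [exists y|move=> u /cH[]|move=> u /cH[]].
pose J := support c0 `|` \bigcup_(V in VV) support (g V).
have KJ : ~ (K #<= J).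
  apply: small_setU => //.
    exact/small_countable/finite_set_countable/finite_support.
  apply: regular_card_bigcup => // V _.
  exact/small_countable/finite_set_countable/finite_support.
have [q Fq qJ] := off J KJ.
have aq : away q by move=> i /qJ nJ ci; apply: nJ; left.
have [_ [w2 qw2] [ O1 [ O2 [oO1 oO2 O12 eO1 eO2]]]] := Fsep q Fq.
(* No [V] fits inside: merging a point of [g V] with one of [q.2] gives a point of [box e] that [h]
   maps into both [O1] and [O2]. *)
exists (OE `&` O1); split; first exact: openI.
  split=> //; apply: eO1 => //.
  apply: (eq_box (supported_support (c := q.1)) _ (wP q Fq)) => i qi.
  by rewrite (zq q) //; left.
move=> V VVV VO.
have [[u gu] ge gV] := gP V VVV (fun x Vx => (VO x Vx).1).
have gJ : supported J (g V).
  by move=> p pg; right; exists V => //; exists p.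
have q2J : supported (~` J) q.2.
  by move=> p pq; apply: qJ; right; exists p.
have [gm q2m] := box_merge gJ q2J gu qw2.
have : set0 (h (merge J u w2)); last by [].
by rewrite -O12; split; [exact: (VO _ (gV _ gm)).2|exact: eO2 (ge _ gm) q2m].
Qed.

(** A homeomorphism taking [p] to the point found above carries [VV] along without enlarging it. *)
Lemma large_pi_character (p : X) (VV : set (set X)) : homogeneous X ->
  ~ (K #<= VV) -> (forall V, VV V -> open V /\ V !=set0) ->
  exists O, [/\ open O, O p & forall V, VV V -> ~ (V `<=` O)].
Proof.
move=> X_homog KVV VVo; have [p0 p0P] := exists_large_pi_character.
have [f [g [fK [gK [fc [gc fp]]]]]] := X_homog p p0.
have [| |O [oO Op OV]] := p0P ((fun V => g @^-1` V) @` VV).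
- by apply: small_le KVV; exact: card_image_le.
- move=> _ [V /VVo[oV [v Vv]] <-]; split; first exact: (continuousP g).1.
  by exists (f v); rewrite /= fK.
exists (f @^-1` O); split; first exact: (continuousP f).1.
  by rewrite /= fp.
move=> V VVV VO; apply: (OV (g @^-1` V)); first by exists V.
by move=> x /VO /=; rewrite gK.
Qed.

End fixed_cardinal.

(** * Thinning out a base by transfinite recursion *)

Section omega_op_like_base.
Hypothesis X_homog : homogeneous X.
Context {S : Type} (K : set S).
Hypothesis K_regular : regular_card K.
Hypothesis K_uncountable : ~ countable K.
Hypothesis K_Bas : forall i, ~ (K #<= Bas i).
Hypothesis K_weight : forall B : set (set X), is_base B -> K #<= B.
Context (B0 : set (set X)).
Hypothesis B0_base : is_base B0.
Hypothesis B0_min : forall B : set (set X), is_base B -> B0 #<= B.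

Lemma image_compact : compact [set: X].
Proof.
rewrite (_ : [set: X] = h @` setT); last first.
  by apply/seteqP; split=> // x _; have [z] := h_surj x; exists z.
apply: continuous_compact; first exact: continuous_subspaceT.
exact: product_compact.
Qed.

Lemma open_shrink (U : set X) (x : X) : open U -> U x ->
  exists N, [/\ open N, N x & closure N `<=` U].
Proof.
move=> oU Ux.
have [||N Nx NU] := @compact_regular X x setT X_hausdorff image_compact _ U.
- exact: filterT.
- exact: open_nbhs_nbhs.
exists N°; split; [exact: open_interior|exact: Nx|].
by apply: subset_trans NU; apply: closure_subset; exact: interior_subset.
Qed.

Lemma exists_nbhd_avoiding_boxes (J : set I) (W : set X) (p : X) :
  ~ (B0 #<= J) -> open W -> W p -> exists O, [/\ open O, O p, O `<=` W &
    forall c, basic c -> supported J c -> fat (box c) ->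
      ~ (forall z, box c z -> O (h z))].
Proof.
move=> B0J oW Wp.
(* When [J] has at least [K] elements, the successor of [|J|] replaces [K]; it is still at most the
   weight, as [J] is smaller than [B0]. *)
have [S' [K' [K'reg K'unc K'Bas K'w K'J]]] : exists (S' : Type) (K' : set S'),
    [/\ regular_card K', ~ countable K', forall i, ~ (K' #<= Bas i),
    forall B : set (set X), is_base B -> K' #<= B & ~ (K' #<= J)].
  have [KJ|KJ] := pselect (K #<= J); last by exists S, K.
  have Jinf : infinite_set J.
    by move=> /(card_le_finite KJ); exact: K_regular.1.
  have [S' [K' [K'reg K'J K'min]]] := exists_succ_card Jinf.
  exists S', K'; split=> //.
  - by move=> K'c; apply: K'J; apply: (card_le_trans K'c); exact/infiniteP.
  - move=> i K'B; apply: K'J; apply: (card_le_trans K'B).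
    by have [/K_Bas//|BK] := card_le_total K (Bas i); exact: card_le_trans BK KJ.
  - move=> B bB; apply: K'min => BJ; apply: B0J.
    exact: card_le_trans (B0_min bB) BJ.
have /choice[g gP] : forall c, exists O : set X, fat (box c) -> [/\ open O, O !=set0 &
    forall O', open O' -> O' !=set0 -> O' `<=` O -> exists2 z, box c z & O' (h z)].
  move=> c; have [[ O OP]|nf] := pselect (fat (box c)); first by exists O.
  by exists set0.
pose Cd := [set c | [/\ basic c, supported J c & fat (box c)]].
have [| |O1 [oO1 O1p O1V]] := large_pi_character K'reg K'unc K'Bas K'w p X_homog (VV := g @` Cd).
- apply: (@small_le _ _ _ _ _ _ (card_image_le _ _)).
  apply: (small_sub (B := [set c | basic c /\ supported J c])); first by move=> c [].
  exact: small_basic_codes.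
- by move=> _ [c [_ _ fc] <-]; have [] := gP c fc.
(* An image inside [N] would, by density, force [g c] into [closure N] and hence into [O1]. *)
have [N [oN Np NO]] := open_shrink (openI oO1 oW) (conj O1p Wp).
exists N; split=> //; first by move=> x /subset_closure/NO[].
move=> c bc Jc fc cN; have [oO O0 OP] := gP c fc.
apply: (O1V (g c)); first by exists c.
move=> x gx; suff /NO[] : closure N x by [].
apply: contrapT => nNx.
have [| |z cz [_]] := OP (g c `&` ~` closure N) _ _ (@subIsetl _ _ _).
- by apply: openI => //; apply: closed_openC; exact: closed_closure.
- by exists x.
- by apply; apply: subset_closure; exact: cN.
Qed.

(* J is the set of coordinates used before, T that of the current stage. *)
Definition touches (J : set I) (T : seq {classic I}) (U : set X) :=
  forall c, basic c -> fat (box c) -> (forall z, box c z -> U (h z)) ->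
    exists i : {classic I}, [/\ support c i, i \in T & ~ J i].

(** Compactness of [closure V] reduces this to one point. There [T] collects the coordinates of
    finitely many boxes that cover the preimage of [closure U] and are mapped into a neighbourhood
    [O] avoiding images of basic fat boxes supported by [J]. *)
Lemma exists_finite_stage (B : set (set X)) (J : set I) (V W : set X) :
  is_base B -> ~ (B0 #<= J) -> open W -> closure V `<=` W ->
  exists (UU : seq {classic set X}) (T : seq {classic I}),
    (forall U : {classic set X}, U \in UU -> [/\ B U, U `<=` W & touches J T U]) /\
    (forall x, V x -> exists2 U : {classic set X}, U \in UU & (U : set X) x).
Proof.
move=> bB B0J oW VW.
pose Q (A : set X) := exists (UU : seq {classic set X}) (T : seq {classic I}),
    (forall U : {classic set X}, U \in UU -> [/\ B U, U `<=` W & touches J T U]) /\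
    (forall x, A x -> exists2 U : {classic set X}, U \in UU & (U : set X) x).
have Vc : compact (closure V).
  by apply: subclosed_compact image_compact _ => //; exact: closed_closure.
have QS A A' : A `<=` A' -> Q A' -> Q A.
  by move=> AA' [UU [T [UP A'U]]]; exists UU, T; split=> // x /AA'/A'U.
apply: (QS _ _ (@subset_closure _ V)); apply: (compact_covering_ind (P := Q) Vc) => //.
- by exists [::], [::].
- move=> A A' [UU [T [UP AU]]] [UU' [T' [UP' AU']]].
  exists (UU ++ UU'), (T ++ T'); split.
    move=> U; rewrite mem_cat => /orP[/UP|/UP'] [BU UW tU]; split=> // c bc fc cU;
      have [i [ci iT nJi]] := tU c bc fc cU; exists i; split=> //;
      by rewrite mem_cat iT ?orbT.
  by move=> x [/AU|/AU'] [U UU1 Ux]; exists U => //; rewrite mem_cat UU1 ?orbT.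
move=> p Vp.
have [ O [oO Op OW Oc]] := exists_nbhd_avoiding_boxes B0J oW (VW p Vp).
have [N [oN Np NO]] := open_shrink oO Op.
have [U [BU [Up UN]]] := bB.2 N p oN Np.
have UO : closure U `<=` O by apply: subset_trans NO; exact: closure_subset.
have oO' : open (h @^-1` O) by exact: (continuousP h).1.
have Ac : compact (h @^-1` closure U).
  apply: subclosed_compact product_compact _ => //.
  by apply: preimage_closed; [move=> *; exact: h_cont|exact: closed_closure].
pose Q' (A : set P) := exists F : seq {classic code Xi},
  (forall d : {classic code Xi}, d \in F -> box d `<=` h @^-1` O) /\
  forall z, A z -> exists2 d : {classic code Xi}, d \in F & box d z.
have [F [FO AF]] : Q' (h @^-1` closure U).
  apply: (compact_covering_ind (P := Q') Ac).
  - by exists [::].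
  - by move=> A A' AA' [F [FO A'F]]; exists F; split=> // z /AA'/A'F.
  - move=> A A' [F [FO AF]] [F' [FO' AF']]; exists (F ++ F'); split.
      by move=> d; rewrite mem_cat => /orP[/FO|/FO'].
    by move=> z [/AF|/AF'] [d dF dz]; exists d; rewrite // mem_cat dF ?orbT.
  - move=> z /UO Oz; have [d [bd dz dO]] := basic_box_nbhs Bas_base oO' (z := z) Oz.
    exists (box d); split=> //; first exact: open_box bd.
    exists [:: d : {classic code Xi}]; split.
      by move=> d'; rewrite inE => /eqP ->.
    by move=> w dw; exists d; rewrite ?mem_head.
exists U; split=> //; first exact: bB.1.
pose T : seq {classic I} :=
  flatten [seq [seq (tag p : {classic I}) | p : constraint Xi <- d] | d : {classic code Xi} <- F].
exists [:: U : {classic set X}], T; split; last first.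
  by move=> x Ux; exists U; rewrite ?mem_head.
move=> U'; rewrite inE => /eqP ->; split=> //.
  by move=> x /subset_closure/UO/OW.
move=> c bc fc cU; apply: contrapT => no.
(* If [c] met [T] only inside [J], its restriction to [T] would be a fat box supported by [J]. Its
   image would lie in [O]: each of its points agrees on [T] with a point of [c], which lies in a box
   of [F], and these depend on [T] only. *)
pose T' : set I := [set i | (i : {classic I}) \in T].
apply: (Oc (restrict T' c)).
- exact: basic_restrict.
- move=> q; rewrite mem_filter => /andP[/asboolP Tq qc].
  by apply: contrapT => nJ; apply: no; exists (tag q); split=> //; exists q.
- by apply: fat_sub fc; exact: sub_box_restrict.
move=> z cz; have [w cw] := fat_nonempty fc.
have cm : box c (merge T' z w).
  apply: (box_restrictC (J := T')).
    apply: (eq_box (@supported_restrict _ _ _ _) _ cz) => i Ti; by rewrite mergeL.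
  apply: (eq_box (@supported_restrict _ _ _ _) _ (sub_box_restrict cw)) => i Ti.
  by rewrite mergeR.
have [d dF dm] := AF _ (subset_closure (cU _ cm)).
apply: (FO d dF); apply: (eq_box (J := T') _ _ dm) => [q qd|i Ti].
  by apply/flatten_mapP; exists d => //; apply/mapP; exists q.
by rewrite mergeL.
Qed.

Lemma exists_omega_op_like_base (B : set (set X)) : is_base B ->
  exists B', [/\ B' `<=` B, is_base B' & forall U, B' U -> finite_set (supersets B' U)].
Proof.
move=> bB.
have B0inf : infinite_set B0.
  by move=> /(card_le_finite (K_weight B0_base)); exact: K_regular.1.
pose L := [set q : set X * set X | [/\ B0 q.1, B0 q.2 & closure q.1 `<=` q.2]].
have LB0 : L #<= B0.
  apply: (@card_le_trans _ _ _ (B0 `*` B0)); last exact: card_le_sqr.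
  by apply: subset_card_le => q [].
have [R [Rwf Rtot Rini]] := exists_initial_well_order L.
pose Y : Type := seq {classic set X} * seq {classic I}.
pose good (J : set I) (q : set X * set X) (y : Y) :=
  (forall U : {classic set X}, U \in y.1 -> [/\ B U, U `<=` q.2 & touches J y.2 U]) /\
  (forall x, q.1 x -> exists2 U : {classic set X}, U \in y.1 & (U : set X) x).
have /choice[s sP] : forall Jq : set I * (set X * set X), exists y,
    ~ (B0 #<= Jq.1) -> L Jq.2 -> good Jq.1 Jq.2 y.
  move=> [J q] /=; have [[B0J Lq]|no] := pselect (~ (B0 #<= J) /\ L q); last first.
    by exists ([::], [::]) => B0J Lq; case: no.
  have [_ Bq2 qq] := Lq.
  have [UU [T UT]] := exists_finite_stage bB B0J (B0_base.1 _ Bq2) qq.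
  by exists (UU, T).
pose before (q : set X * set X) (f : forall r, R r q -> Y) : set I :=
  [set i | exists r (Rr : R r q), L r /\ (i : {classic I}) \in (f r Rr).2].
(* The choice made at stage [q] depends on earlier stages only through the coordinates they used. *)
pose st : set X * set X -> Y :=
  Fix Rwf (fun=> Y) (fun q f => s (before q f, q)).
pose J q := before q (fun r _ => st r).
have stE q : st q = s (J q, q).
  rewrite /st Fix_eq // => {}q f g fg; congr (s (_, q)).
  apply/seteqP; split=> i [r [Rr [Lr ir]]]; exists r, Rr; split=> //.
    by rewrite -fg.
  by rewrite fg.
have B0J q : L q -> ~ (B0 #<= J q).
  move=> Lq; pose seg := [set r | L r /\ R r q].
  have Jseg : J q `<=` \bigcup_(r in seg) [set i : I | (i : {classic I}) \in (st r).2].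
    by move=> i [r [Rr [Lr ir]]]; exists r.
  have fin r : finite_set [set i : I | (i : {classic I}) \in (st r).2].
    exact: (@finite_seq {classic I}).
  (* A finite segment is treated apart, since [card_le_bigcup] needs an infinite bound. *)
  have [segfin|seginf] := pselect (finite_set seg).
    move=> B0J; apply: B0inf; apply: card_le_finite B0J _.
    by apply: sub_finite_set Jseg _; exact: bigcup_finite.
  move=> B0J; apply: (Rini q Lq); apply: (card_le_trans LB0).
  apply: (card_le_trans B0J); apply: (card_le_trans (subset_card_le Jseg)).
  apply: card_le_bigcup => // r _.
  by apply: (card_le_trans (finite_set_countable (fin r))); exact/infiniteP.
have stP q : L q -> good (J q) q (st q).
  by move=> Lq; rewrite stE; apply: (sP (J q, q)) => //; exact: B0J.
(* The empty set is left out: it contains no image of a fat box, and every member would be a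
   superset of it. *)
pose B' := [set U : set X | U !=set0 /\ exists2 q, L q & (U : {classic set X}) \in (st q).1].
have B'B : B' `<=` B by move=> U [_ [q Lq Uq]]; have [] := (stP q Lq).1 U Uq.
exists B'; split=> //.
- split; first by move=> U /B'B/bB.1.
  move=> O x oO Ox.
  have [W [BW [Wx WO]]] := B0_base.2 O x oO Ox.
  have [N [oN Nx NW]] := open_shrink (B0_base.1 _ BW) Wx.
  have [V [BV [Vx VN]]] := B0_base.2 N x oN Nx.
  have Lq : L (V, W).
    by split=> //=; apply: subset_trans NW; exact: closure_subset.
  have [U Uq Ux] := (stP _ Lq).2 x Vx.
  have [_ UW _] := (stP _ Lq).1 U Uq.
  exists U; split; first by split; [exists x|exists (V, W)].
  by split=> //; exact: subset_trans UW WO.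
move=> U B'U.
have [c [bc fc cU]] := exists_fat_box (bB.1 _ (B'B _ B'U)) B'U.1.
(* At most one stage lies in [D i]: of two such stages, the earlier would put [i] into [J] of the
   later. *)
pose D i := [set q | [/\ L q, (i : {classic I}) \in (st q).2 & ~ J q i]].
apply: (@sub_finite_set _ _ (\bigcup_(i in support c) \bigcup_(q in D i)
    [set V : set X | (V : {classic set X}) \in (st q).1])).
  move=> V [[_ [q Lq Vq]] UV].
  have [_ _ tV] := (stP q Lq).1 V Vq.
  have [|i [ci iT nJ]] := tV c bc fc; first by move=> z /cU/UV.
  by exists i => //; exists q.
apply: bigcup_finite; first exact: finite_support.
move=> i _; apply: bigcup_finite; last first.
  by move=> q _; exact: (@finite_seq {classic set X}).
have [[q Dq]|noq] := pselect (exists q, D i q); last first.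
  by apply: sub_finite_set (@finite_set0 (set X * set X)) => q Dq; apply: noq; exists q.
apply: sub_finite_set (finite_set1 q) => r [Lr ir nJr].
have [Lq iq nJq] := Dq; apply: contrapT => /(Rtot r q Lr Lq)[Rrq|Rqr].
  by apply: nJq; exists r, Rrq.
by apply: nJr; exists q, Rqr.
Qed.

End omega_op_like_base.
End image_of_product.

(** * Minimal bases and the two cases of the theorem *)

Lemma is_base_open (X : topologicalType) : is_base (@open X).
Proof. by split=> // U x oU Ux; exists U; split=> //; split=> //; exact: subset_refl. Qed.

Lemma exists_minimal_base (X : topologicalType) : exists B0 : set (set X),
  is_base B0 /\ forall B : set (set X), is_base B -> B0 #<= B.
Proof.
have [[B0 B0b] /= B0min] := @card_min {B : set (set X) | is_base B}
  (fun=> set X) (fun B => sval B) (exist _ _ (@is_base_open X)).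
by exists B0; split=> // B bB; exact: (B0min (exist _ B bB)).
Qed.

(** For each pair from a minimal base, one member of [B] between the two sets is kept, if there is
    one. *)
Lemma exists_subbase_card_le_weight (X : topologicalType) (B : set (set X)) :
  is_base B -> exists B', [/\ B' `<=` B, is_base B' & card_le_weight B' X].
Proof.
move=> bB; have [B0 [bB0 B0min]] := exists_minimal_base X.
have /choice[g gP] : forall q : set X * set X, exists U, forall U',
    B U' -> q.1 `<=` U' -> U' `<=` q.2 -> [/\ B U, q.1 `<=` U & U `<=` q.2].
  move=> q; have [[U [BU qU Uq]]|no] :=
      pselect (exists U, [/\ B U, q.1 `<=` U & U `<=` q.2]); first by exists U.
  by exists set0 => U BU qU Uq; case: no; exists U.
pose B' := B `&` (g @` (B0 `*` B0)).
exists B'; split; first by move=> U [].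
  split=> [U [/bB.1]//|O x oO Ox].
  have [W [BW [Wx WO]]] := bB0.2 O x oO Ox.
  have [U [BU [Ux UW]]] := bB.2 W x (bB0.1 _ BW) Wx.
  have [V [BV [Vx VU]]] := bB0.2 U x (bB.1 _ BU) Ux.
  have [Bg Vg gW] := gP (V, W) U BU VU UW.
  exists (g (V, W)); split; first by split=> //; exists (V, W).
  by split; [exact: Vg|exact: subset_trans gW WO].
have B'le : B' #<= B0 `*` B0.
  by apply: card_le_trans (card_image_le g _); apply: subset_card_le => U [].
(* For finite [B0] the bound comes from the convention that weights are infinite. *)
have [fin|inf] := pselect (finite_set B0).
  by left; apply: (card_le_trans B'le); apply/finite_set_countable/finite_setX.
right=> B1 /B0min B01; apply: (card_le_trans B'le).
exact: card_le_trans (card_le_sqr inf) B01.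
Qed.

(** Covers the empty index set, where the product is a point and [K] may be countable. *)
Lemma subsingleton_base (X : topologicalType) (B : set (set X)) :
  (forall x y : X, x = y) -> is_base B ->
  exists B', [/\ B' `<=` B, is_base B' & forall U, B' U -> finite_set (supersets B' U)].
Proof.
move=> X1 bB; have full (U : set X) x : U x -> U = setT.
  by move=> Ux; apply/seteqP; split=> // y _; rewrite (X1 y x).
exists (B `&` [set setT]); split; first by move=> U [].
  split=> [U [/bB.1]//|U x oU Ux].
  have [V [BV [Vx VU]]] := bB.2 U x oU Ux.
  by exists V; split=> //; split=> //; exact: full Vx.
by move=> U _; apply: sub_finite_set (finite_set1 (setT : set X)) => V [[]].
Qed.

(** If some infinite [A] bounded all [w(X_i)] but not [w(X)], its successor would be a regular
    cardinal of the excluded kind. *)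
Lemma weight_le_supweight_of_no_regular (I : Type) (Xi : I -> topologicalType)
    (X : topologicalType) :
  ~ (exists (S : Type) (K : set S), regular_card K /\
       (forall i, weight_lt (Xi i) K) /\ card_le_weight K X) ->
  weight_le_supweight X Xi.
Proof.
move=> noK C A Ainf XiA; apply: contrapT => XA; apply: noK.
have [S [K [Kreg KA Kmin]]] := exists_succ_card Ainf.
exists S, K; split=> //; split.
  move=> i [Kc|Kw].
    by apply: KA; apply: (card_le_trans Kc); exact/infiniteP.
  have [_ [B [bB BA]]] := XiA i.
  by apply: KA; exact: card_le_trans (Kw B bB) BA.
by right=> B bB; apply: Kmin => BA; apply: XA; split=> //; exists B.
Qed.

Theorem theorem3p33 (I : Type) (Xi : I -> topologicalType) (X : topologicalType)
  (Xi_compact : forall i, compact [set: Xi i])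
  (Xi_hausdorff : forall i, hausdorff_space (Xi i))
  (X_compact : compact [set: X]) (X_hausdorff : hausdorff_space X)
  (X_homog : homogeneous X)
  (h : prod_topology Xi -> X) (h_cont : continuous h) (h_surj : forall y : X, exists x, h x = y) :
  ((exists (S : Type) (K : set S), regular_card K /\
       (forall i, weight_lt (Xi i) K) /\ card_le_weight K X) ->
     forall B : set (set X), is_base B ->
       exists B' : set (set X), B' `<=` B /\ is_base B' /\
         forall U, B' U -> card_lt_supweight Xi (supersets B' U))
  /\
  (~ (exists (S : Type) (K : set S), regular_card K /\
       (forall i, weight_lt (Xi i) K) /\ card_le_weight K X) ->
     weight_le_supweight X Xi /\
     forall B : set (set X), is_base B ->
       exists B' : set (set X), B' `<=` B /\ is_base B' /\
         forall U, B' U -> card_le_weight (supersets B' U) X).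
Proof.
split=> [[S [K [Kreg [XiK KX]]]] B bB|noK]; last first.
  split; first exact: weight_le_supweight_of_no_regular.
  move=> B bB; have [B' [B'B bB' B'w]] := exists_subbase_card_le_weight bB.
  exists B'; split=> //; split=> // U _.
  have sub : supersets B' U #<= B' by apply: subset_card_le => V [].
  case: B'w => [B'c|B'w]; [left|right=> B1 /B'w].
    exact: card_le_trans sub B'c.
  exact: card_le_trans sub.
suff [B' [B'B bB' B'fin]] : exists B', [/\ B' `<=` B, is_base B' &
    forall U, B' U -> finite_set (supersets B' U)].
  by exists B'; split=> //; split=> // U /B'fin; left.
have [[i0 _]|noI] := pselect (exists i : I, True); last first.
  apply: subsingleton_base bB => x y.
  have [z <-] := h_surj x; have [w <-] := h_surj y.
  by congr h; apply: functional_extensionality_dep => i; case: noI; exists i.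
(* Weights are infinite by convention, so a cardinal above the weight of [Xi i0] is uncountable. *)
have Kunc : ~ countable K by move=> Kc; apply: (XiK i0); left.
have basK i : exists Bi : set (set (Xi i)), is_base Bi /\ ~ (K #<= Bi).
  apply: contrapT => no; apply: (XiK i); right=> Bi bBi.
  by apply: contrapT => KBi; apply: no; exists Bi.
pose Bas i := sval (cid (basK i)).
have Bas_base i : is_base (Bas i) := (svalP (cid (basK i))).1.
have KBas i : ~ (K #<= Bas i) := (svalP (cid (basK i))).2.
have Kw (B1 : set (set X)) : is_base B1 -> K #<= B1 by case: KX => // KX; exact: KX.
have [B0 [bB0 B0min]] := exists_minimal_base X.
exact: (exists_omega_op_like_base Bas_base Xi_compact Xi_hausdorff X_hausdorff
  h_cont h_surj X_homog Kreg Kunc KBas Kw bB0 B0min bB).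
Qed.
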